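(* Let $w(n) \ge 0$ ($n \in \mathbb{N}$) be a system of nonnegative weights. Let $\alpha, \beta, c, \gamma, \eta$ be positive real constants and suppose that a sequence of real numbers $\{A(n)\}_{n \in \mathbb{N}}$ satisfies, for all $\epsilon > 0$, \begin{enumerate} \item $A(n) \ll n^{\alpha+\epsilon}$, \item $\sum_{n \le X} A(n) w(n) \ll X^{\beta+\epsilon}$, \item $\sum_{n \le X} A^2(n) w(n) = c X^{\gamma} + O(X^{\eta+\epsilon})$. \end{enumerate} Then for any $r$ with $$\max(\alpha+\beta, \eta) - (\gamma - 1) < r < 1,$$ there is an $X_0$ such that for all $X \ge X_0$ the sequence $\{A(n) w(n)\}_{n\in\mathbb{N}}$ has at least one sign change for $n$ in the interval $[X, X + X^r]$.
   Context: $\mathbb{N}$ denotes the positive integers. All implicit constants may depend on $\epsilon$. A real sequence has a sign change in an interval if there are two indices in the interval at which its terms are nonzero and of opposite signs. *)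

(* Defs.v *)
From HB Require Import structures.
From mathcomp Require Import all_boot all_order all_algebra.
From mathcomp Require Import all_classical all_reals all_analysis.

Set Implicit Arguments.
Unset Strict Implicit.
Unset Printing Implicit Defensive.

Import Order.TTheory GRing.Theory Num.Theory.
Import numFieldNormedType.Exports.

Local Open Scope classical_set_scope.
Local Open Scope ring_scope.

(* Sequences are indexed by the positive integers: a sequence is a function on
   [nat] whose value at 0 is never used. *)

(* Sum of [f n] over the integers 1 <= n <= X, for a real X >= 0; the sum is
   empty for X < 1, since [Num.truncn] is 0 there. *)
Definition psum (R : realType) (f : nat -> R) (X : R) : R :=
  \sum_(1 <= n < (Num.truncn X).+1) f n.

Definition sign_change_in (R : realType) (f : nat -> R) (a b : R) : Prop :=
  exists m n : nat,
    [/\ (0 < m)%N /\ a <= m%:R <= b,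
        (0 < n)%N /\ a <= n%:R <= b,
        f m < 0 & 0 < f n].

(* Landau notations need a bundled filter, which [pinfty_nbhs] lacks. *)
Canonical pinfty_filter_on (R : numFieldType) : filter_on R :=
  FilterType (pinfty_nbhs R) _.

(* Main.v *)
(* Without a sign change on [X, X + X^r] one has |sum A w| = sum |A| w there, so
   sum A^2 w <= max |A| * |sum A w| = O(X^(alpha + beta + 2 eps)).  The second
   moment bounds the same sum below by a constant times X^(gamma - 1 + r), up to
   O(X^(eta + eps)), because (X + h)^gamma - X^gamma >> h X^(gamma - 1).  The
   hypothesis on r makes these incompatible for small eps and large X. *)

Require Import Defs.
From HB Require Import structures.
From mathcomp Require Import all_boot all_order all_algebra.
From mathcomp Require Import all_classical all_reals all_analysis.
From mathcomp Require Import lra ring.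

Set Implicit Arguments.
Unset Strict Implicit.
Unset Printing Implicit Defensive.

Import Order.TTheory GRing.Theory Num.Theory.
Import numFieldNormedType.Exports.

Local Open Scope classical_set_scope.
Local Open Scope ring_scope.

(** Writing the power as [expR (g * ln (1 + t))], the bound [1 + u <= expR u] reduces the claim to
    [t / 2 <= ln (1 + t)]. This treats all [g > 0] at once, without separating the convex and
    concave cases. *)
Lemma powR_add1_sub1_ge (R : realType) (g t : R) :
  0 < g -> 0 <= t <= 1 -> g / 2 * t <= (1 + t) `^ g - 1.
Proof.
move=> g_gt0 /andP[t_ge0 t_le1].
have t1_gt0 : 0 < 1 + t by lra.
have ln_ge : t / 2 <= ln (1 + t).
  (* [ln (1 + t) = - ln (1 / (1 + t)) >= 1 - 1 / (1 + t) = t / (1 + t)] *)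
  have : ln (1 + ((1 + t)^-1 - 1)) <= (1 + t)^-1 - 1.
    by apply: le_ln1Dx; have := t1_gt0; rewrite -invr_gt0; lra.
  rewrite addrC subrK lnV ?posrE // => lnV_le.
  have : t * (1 + t)^-1 >= t / 2.
    by apply: ler_wpM2l => //; rewrite lef_pV2 ?posrE; lra.
  have : t * (1 + t)^-1 = 1 - (1 + t)^-1 by field; rewrite gt_eqF.
  lra.
rewrite /powR gt_eqF //.
have := expR_ge1Dx (g * ln (1 + t)).
have : g * (t / 2) <= g * ln (1 + t) by rewrite ler_pM2l.
lra.
Qed.

Lemma powR_short_interval_ge (R : realType) (g x h : R) :
  0 < g -> 0 < x -> 0 <= h <= x ->
  g / 2 * (h * x `^ (g - 1)) <= (x + h) `^ g - x `^ g.
Proof.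
move=> g_gt0 x_gt0 /andP[h_ge0 h_lex].
have x_neq0 : x != 0 by rewrite gt_eqF.
have -> : x + h = x * (1 + h / x) by field.
have hx_itv : 0 <= h / x <= 1.
  by rewrite divr_ge0 ?(ltW x_gt0)//= ler_pdivrMr// mul1r.
have := powR_add1_sub1_ge g_gt0 hx_itv.
have xg_gt0 : 0 < x `^ g by rewrite powR_gt0.
rewrite -(ler_pM2l xg_gt0) => le_xg.
rewrite powRM ?(ltW x_gt0)//; last by lra.
apply: le_trans (_ : _ <= x `^ g * (g / 2 * (h / x))) _; last by lra.
rewrite powRD ?x_neq0 ?implybT// powR_inv1 ?(ltW x_gt0)//.
by lra.
Qed.

Lemma ler_powR2 (R : realType) (x y p q : R) :
  1 <= x -> x <= y -> p <= q -> 0 <= q -> x `^ p <= y `^ q.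
Proof.
move=> x_ge1 le_xy le_pq q_ge0.
apply: le_trans (ler_powR x_ge1 le_pq) _.
by apply: ge0_ler_powR => //; rewrite nnegrE; lra.
Qed.

Lemma psumB (R : realType) (f : nat -> R) (X Y : R) : X <= Y ->
  psum f Y - psum f X =
  \sum_((Num.truncn X).+1 <= n < (Num.truncn Y).+1) f n.
Proof.
move=> le_XY; rewrite /psum (@big_cat_nat _ _ _ (Num.truncn X).+1 1)//=.
  by rewrite addrAC subrr add0r.
by rewrite ltnS le_truncn.
Qed.

(** The hypothesis is the absence of a sign change, zero terms being allowed: either some term is
    negative and then all are nonpositive, or all are nonnegative. *)
Lemma norm_sum_same_sign (R : realDomainType) (m n : nat) (f : nat -> R) :
  (forall i j, (m <= i < n)%N -> (m <= j < n)%N -> f i < 0 -> f j <= 0) ->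
  \sum_(m <= i < n) `|f i| = `|\sum_(m <= i < n) f i|.
Proof.
move=> same_sign.
have [[i [i_in fi_lt0]]|no_neg] :=
  pselect (exists i, (m <= i < n)%N /\ f i < 0).
  rewrite ler0_norm; last first.
    by rewrite big_nat_cond sumr_le0// => j /andP[j_in _]; exact: (same_sign i).
  rewrite -sumrN; apply: eq_big_nat => j j_in.
  by rewrite ler0_norm// (same_sign i).
have f_ge0 j : (m <= j < n)%N -> 0 <= f j.
  by move=> j_in; rewrite leNgt; apply/negP => fj; apply: no_neg; exists j.
rewrite ger0_norm; first by apply: eq_big_nat => j /f_ge0/ger0_norm.
by rewrite big_nat_cond sumr_ge0// => j /andP[/f_ge0].
Qed.

(** Termwise [A n ^+ 2 * w n <= M * |A n * w n|], and the absolute values may be moved outside the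
    sum when the terms share a sign. *)
Lemma sum_sqr_weight_le (R : realType) (w A : nat -> R) (a b M : R) :
  (forall n : nat, (0 < n)%N -> 0 <= w n) -> 0 <= a <= b ->
  (forall n : nat, a <= n%:R <= b -> `|A n| <= M) ->
  ~ sign_change_in (fun n => A n * w n) a b ->
  psum (fun n => A n ^+ 2 * w n) b - psum (fun n => A n ^+ 2 * w n) a <=
  M * `|psum (fun n => A n * w n) b - psum (fun n => A n * w n) a|.
Proof.
move=> w_ge0 /andP[a_ge0 le_ab] A_le no_change.
have b_ge0 : 0 <= b by exact: le_trans le_ab.
(* The differences of partial sums run over [a < n <= b], so every index is positive and lies in the
   closed interval. *)
have in_itv n : ((Num.truncn a).+1 <= n < (Num.truncn b).+1)%N ->
    a <= n%:R <= b.
  move=> /andP[an]; rewrite ltnS truncn_ge_nat// => ->; rewrite andbT.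
  by apply: ltW; apply: lt_le_trans (truncnS_gt a) _; rewrite ler_nat.
rewrite !psumB// -norm_sum_same_sign; last first.
  move=> i j i_in j_in fi_lt0; rewrite leNgt; apply/negP => fj_gt0.
  apply: no_change; exists i, j.
  by split=> //; split; rewrite ?in_itv//;
    [case/andP: i_in | case/andP: j_in]; case: (i) (j) => [|?] [|?].
rewrite big_distrr/=; apply: ler_sum_nat => n n_in.
have w_n : 0 <= w n by apply: w_ge0; case/andP: n_in; case: (n).
rewrite normrM (ger0_norm w_n) mulrA ler_wpM2r//.
by rewrite -(real_normK (num_real (A n))) expr2 ler_wpM2r// A_le// in_itv.
Qed.

Theorem theorem3 (R : realType) (w A : nat -> R) (alpha beta c gamma eta : R)
    (w_ge0 : forall n : nat, (0 < n)%N -> 0 <= w n)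
    (alpha_gt0 : 0 < alpha) (beta_gt0 : 0 < beta) (c_gt0 : 0 < c)
    (gamma_gt0 : 0 < gamma) (eta_gt0 : 0 < eta)
    (A_bound : forall eps : R, 0 < eps ->
      A =O_ \oo (fun n : nat => n%:R `^ (alpha + eps)))
    (first_moment : forall eps : R, 0 < eps ->
      psum (fun n => A n * w n) =O_ +oo (fun X : R => X `^ (beta + eps)))
    (second_moment : forall eps : R, 0 < eps ->
      psum (fun n => A n ^+ 2 * w n) =
        (fun X : R => c * X `^ gamma) +O_ +oo (fun X : R => X `^ (eta + eps)))
    (r : R) (r_gt : Num.max (alpha + beta) eta - (gamma - 1) < r) (r_lt1 : r < 1) :
  exists X0 : R, forall X : R, X0 <= X ->
    sign_change_in (fun n => A n * w n) X (X + X `^ r).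
Proof.
have [ab_lt e_lt] : alpha + beta < r + (gamma - 1) /\ eta < r + (gamma - 1).
  by move: r_gt; rewrite ltrBlDr gt_max => /andP[].
pose M := Num.max (alpha + beta) eta.
pose eps := (r + (gamma - 1) - M) / 3.
have M_lt : M < r + (gamma - 1) by rewrite gt_max ab_lt.
have ab_le : alpha + beta <= M by rewrite le_max lexx.
have e_le : eta <= M by rewrite le_max lexx orbT.
have eps_gt0 : 0 < eps by rewrite /eps; lra.
pose Q := M + 2 * eps.
have Q_ge0 : 0 <= Q by rewrite /Q; lra.
have rE : r + (gamma - 1) = Q + eps by rewrite /Q /eps; lra.
have /eqO_exP[ka ka_gt0 [Na _ Aa]] := A_bound _ eps_gt0.
have /eqO_exP[kb kb_gt0 [Nb [_ Ab]]] := first_moment _ eps_gt0.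
have /eqaddOP/bigO_exP[ke ke_gt0 [Ne [_ Ae]]] := second_moment _ eps_gt0.
pose K := 2 * (ka * kb + ke) * 2 `^ Q.
pose Z := (K * 2 / (c * gamma)) `^ eps^-1.
(* The bounds at [+oo] hold strictly beyond [Nb] and [Ne], and [Z < X] must be strict, hence the
   added 1s. *)
exists (Num.max 1 (Num.max Na%:R (Num.max (Nb + 1) (Num.max (Ne + 1) (Z + 1))))).
move=> X; rewrite !ge_max => /and5P[X_ge1 Na_le Nb_le Ne_le Z_le].
apply: contrapT => no_change.
have X_gt0 : 0 < X by lra.
have X_neq0 : X != 0 by rewrite gt_eqF.
have h_ge0 : 0 <= X `^ r by exact: powR_ge0.
have h_le : X `^ r <= X.
  by rewrite -[leRHS]powRr1 ?(ltW X_gt0)// ler_powR// ltW.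
set Y := X + X `^ r in no_change *.
have [le_XY le_Y2] : X <= Y /\ Y <= 2 * X by rewrite /Y; lra.
pose T := (2 * X) `^ Q.
have A_le n : X <= n%:R <= Y -> `|A n| <= ka * (2 * X) `^ (alpha + eps).
  move=> /andP[Xn nY].
  apply: le_trans (Aa n _) _.
    by rewrite /= -(ler_nat R); exact: le_trans Xn.
  by rewrite ger0_norm ?powR_ge0// ler_pM2l// ler_powR2//; lra.
have S1_le x : X <= x <= 2 * X ->
    `|psum (fun n => A n * w n) x| <= kb * (2 * X) `^ (beta + eps).
  move=> /andP[Xx xX].
  apply: le_trans (Ab x _) _; first by lra.
  by rewrite ger0_norm ?powR_ge0// ler_pM2l// ler_powR2//; lra.
have S2_le x : X <= x <= 2 * X ->
    `|psum (fun n => A n ^+ 2 * w n) x - c * x `^ gamma| <= ke * T.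
  move=> /andP[Xx xX].
  apply: le_trans (Ae x _) _; first by lra.
  rewrite ger0_norm ?powR_ge0// ler_pM2l// ler_powR2//; first by lra.
  by rewrite /Q; lra.
have XX : X <= X <= 2 * X by lra.
have YX : X <= Y <= 2 * X by lra.
have main := sum_sqr_weight_le w_ge0 (ltac:(lra) : 0 <= X <= Y) A_le no_change.
have diff1 : `|psum (fun n => A n * w n) Y - psum (fun n => A n * w n) X| <=
    2 * (kb * (2 * X) `^ (beta + eps)).
  have := ler_normB (psum (fun n => A n * w n) Y) (psum (fun n => A n * w n) X).
  have := S1_le _ XX; have := S1_le _ YX; lra.
have prod_le : (2 * X) `^ (alpha + eps) * (2 * X) `^ (beta + eps) <= T.
  rewrite -powRD; last by rewrite (_ : 2 * X != 0) ?implybT// gt_eqF//; lra.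
  by apply: ler_powR; rewrite /Q; lra.
have {}main : psum (fun n => A n ^+ 2 * w n) Y -
    psum (fun n => A n ^+ 2 * w n) X <= 2 * (ka * kb) * T.
  apply: le_trans main _.
  apply: le_trans (ler_wpM2l _ diff1) _.
    by rewrite mulr_ge0 ?powR_ge0// ltW.
  rewrite [leLHS](_ : _ = 2 * (ka * kb) *
    ((2 * X) `^ (alpha + eps) * (2 * X) `^ (beta + eps))); last by ring.
  by rewrite ler_wpM2l// !mulr_ge0// ltW.
(* With [h = X]^ r[, the main term of the second moment grows by at least]c * gamma / 2 * X
   [^ (Q + eps)]. *)
have := powR_short_interval_ge gamma_gt0 X_gt0 (ltac:(lra) : 0 <= X `^ r <= X).
rewrite -/Y -powRD; last first.
  by rewrite X_neq0 implybT.
rewrite rE powRD; last by rewrite X_neq0 implybT.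
rewrite -(ler_pM2l c_gt0) => lower.
have TE : T = 2 `^ Q * X `^ Q by rewrite /T powRM// ltW.
have XQ_gt0 : 0 < X `^ Q by rewrite powR_gt0.
(* The growth of the main term is at most the second moment over the interval plus one error
   [ke * T] per endpoint. *)
have : X `^ Q * (c * gamma / 2 * X `^ eps) <= X `^ Q * K.
  have := S2_le _ XX; have := S2_le _ YX.
  rewrite !ler_norml => /andP[Y1 Y2] /andP[X1 X2].
  rewrite (_ : X `^ Q * K = 2 * (ka * kb) * T + 2 * (ke * T)); last first.
    by rewrite TE /K; ring.
  lra.
rewrite ler_pM2l//; apply/negP; rewrite -ltNge.
have K_gt0 : 0 < K by rewrite /K !mulr_gt0 ?addr_gt0 ?mulr_gt0 ?powR_gt0.
have cg_gt0 : 0 < c * gamma by exact: mulr_gt0.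
have : Z `^ eps < X `^ eps.
  by rewrite gt0_ltr_powR// ?nnegrE ?powR_ge0 ?(ltW X_gt0)//; lra.
rewrite -powRrM mulVf ?gt_eqF// powRr1; last first.
  by rewrite ltW// divr_gt0// mulr_gt0.
rewrite ltr_pdivrMr//; lra.
Qed.
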